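(* Let $d\ge1$, $\epsilon>0$, $s<0$ and $T>0$. Consider on $\mathbb{T}^d$ the Cauchy problem $$i\partial_t u+\Delta u-\epsilon^2\Delta^2u=-\big((I-\epsilon^2\Delta)^{-1}(|u|^2)\big)u,\qquad u(0)=u_0 .$$ Then uniform well-posedness in $H^s(\mathbb{T}^d)$ fails: the solution map $u_0\mapsto u$, if it exists as a map from $H^s(\mathbb{T}^d)$ to $C([0,T];H^s(\mathbb{T}^d))$, is not uniformly continuous on bounded subsets of $H^s(\mathbb{T}^d)$.
   Context: $(I-\epsilon^2\Delta)^{-1}$ is the Fourier multiplier on $\mathbb{T}^d$ with symbol $(1+\epsilon^2|n|^2)^{-1}$, $n\in\mathbb{Z}^d$. ''The solution map, if it exists'' means any map $H^s(\mathbb{T}^d)\to C([0,T];H^s(\mathbb{T}^d))$ which, for every smooth initial datum for which the Cauchy problem has a (necessarily unique) smooth solution on $[0,T]$, returns that smooth solution. *)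

(* Defs.v *)
From HB Require Import structures.
From mathcomp Require Import all_boot all_order all_algebra.
From mathcomp Require Import complex.
From mathcomp Require Import all_classical all_reals all_analysis.

Set Implicit Arguments.
Unset Strict Implicit.
Unset Printing Implicit Defensive.

Import Order.TTheory GRing.Theory Num.Theory.
Import numFieldNormedType.Exports.

Local Open Scope classical_set_scope.
Local Open Scope ring_scope.
Local Open Scope complex_scope.

(* The torus is (R / 2 pi Z)^d: functions on it are functions of x : 'rV[R]_d
   that are 2 pi-periodic in each coordinate, the frequencies are the
   n : 'rV[int]_d, and the characters are x |-> exp(i n.x). *)

(* R[i] carries no normed-space structure over R, so complex-valued functions
   are differentiated and integrated through their real and imaginary parts. *)

Definition iter_deriv {R : realType} {V : normedModType R}
    (vs : seq V) (f : V -> R) : V -> R :=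
  foldr (fun v (g : V -> R) => fun x => 'D_v g x) f vs.

Definition smooth_real {R : realType} {V : normedModType R} (f : V -> R) :=
  forall vs : seq V,
    continuous (iter_deriv vs f) /\
    forall x v, derivable (iter_deriv vs f) x v.

Definition smooth {R : realType} {V : normedModType R} (f : V -> R[i]) :=
  smooth_real (fun x => complex.Re (f x)) /\
  smooth_real (fun x => complex.Im (f x)).

Definition cderiv {R : realType} {V : normedModType R}
    (v : V) (f : V -> R[i]) (x : V) : R[i] :=
  ('D_v (fun y => complex.Re (f y)) x) +i* ('D_v (fun y => complex.Im (f y)) x).

Definition laplacian {R : realType} {d : nat}
    (f : 'rV[R]_d -> R[i]) (x : 'rV[R]_d) : R[i] :=
  \sum_(j < d) cderiv (delta_mx 0 j) (cderiv (delta_mx 0 j) f) x.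

Definition torus_periodic {R : realType} {d : nat} (f : 'rV[R]_d -> R[i]) :=
  forall x j, f (x + (2 * pi) *: delta_mx 0 j) = f x.

Definition set_coord {R : realType} {d : nat}
    (x : 'rV[R]_d) (j : 'I_d) (y : R) : 'rV[R]_d :=
  \row_k (if k == j then y else x 0 k).

(* Mean value of g over [0, 2 pi]^d, as an iterated integral over the
   coordinates; it is only used for continuous g. Every coordinate gets
   overwritten, so the final evaluation point 0 is immaterial. *)
Definition torus_mean {R : realType} {d : nat} (g : 'rV[R]_d -> R) : R :=
  (2 * pi) ^- d *
  foldr (fun j (h : 'rV[R]_d -> R) => fun x =>
           \int[lebesgue_measure]_(y in `[0, 2 * pi]) h (set_coord x j y))
        g (enum 'I_d) 0.

Definition dotz {R : realType} {d : nat} (n : 'rV[int]_d) (x : 'rV[R]_d) : R :=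
  \sum_(j < d) (n 0 j)%:~R * x 0 j.

Definition freq_sqr {R : realType} {d : nat} (n : 'rV[int]_d) : R :=
  \sum_(j < d) (n 0 j)%:~R ^+ 2.

Definition character {R : realType} {d : nat}
    (n : 'rV[int]_d) (x : 'rV[R]_d) : R[i] :=
  cos (dotz n x) +i* sin (dotz n x).

Definition fourier {R : realType} {d : nat}
    (f : 'rV[R]_d -> R[i]) (n : 'rV[int]_d) : R[i] :=
  torus_mean (fun x => complex.Re (f x * character (- n) x)) +i*
  torus_mean (fun x => complex.Im (f x * character (- n) x)).

(* g = m(D) f, the Fourier multiplier with symbol m applied to f *)
Definition is_multiplier {R : realType} {d : nat} (m : 'rV[int]_d -> R)
    (f g : 'rV[R]_d -> R[i]) :=
  [/\ smooth g, torus_periodic g & forall n, fourier g n = (m n)%:C * fourier f n].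

(* symbol of (I - eps^2 Delta)^-1 *)
Definition inv_symbol {R : realType} {d : nat} (eps : R) (n : 'rV[int]_d) : R :=
  (1 + eps ^+ 2 * freq_sqr n)^-1.

(* A periodic distribution is represented by the family of its Fourier
   coefficients. The norm takes the value +oo outside H^s; conversely, every
   family with a finite H^s norm grows at most polynomially, hence is the family
   of coefficients of a distribution. *)

Definition coeffs (R : realType) (d : nat) := 'rV[int]_d -> R[i].

Definition Hs_norm {R : realType} {d : nat} (s : R) (f : coeffs R d) : \bar R :=
  sqrte (\esum_(n in [set: 'rV[int]_d])
           ((1 + freq_sqr n) `^ s * complex.Re `|f n| ^+ 2)%:E).

Definition in_Hs {R : realType} {d : nat} (s : R) (f : coeffs R d) :=
  (Hs_norm s f < +oo)%E.

Definition in_CHs {R : realType} {d : nat} (s T : R) (v : R -> coeffs R d) :=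
  (forall t : R, t \in `[0, T] -> in_Hs s (v t)) /\
  (forall t : R, t \in `[0, T] ->
    Hs_norm s (v t' \- v t) @[t' --> within `[0, T] (nbhs t)]
      --> 0%E).

Definition CHs_norm {R : realType} {d : nat} (s T : R) (v : R -> coeffs R d) :
    \bar R :=
  ereal_sup [set Hs_norm s (v t) | t in `[0, T]].

(* Smooth functions on [0, T] x T^d are the restrictions of smooth functions on
   R x T^d; the equation is only required on [0, T], where the time derivative
   does not depend on the extension. *)
Definition smooth_solution {R : realType} {d : nat} (eps T : R)
    (u : R -> 'rV[R]_d -> R[i]) :=
  [/\ smooth (fun z : R * 'rV[R]_d => u z.1 z.2),
      forall t, torus_periodic (u t) &
      forall t : R, t \in `[0, T] ->
        exists2 w : 'rV[R]_d -> R[i],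
          is_multiplier (inv_symbol eps) (fun x => `|u t x| ^+ 2) w &
          forall x,
            'i%C * cderiv (V := R) 1 (fun t' => u t' x) t + laplacian (u t) x
              - (eps ^+ 2)%:C * laplacian (laplacian (u t)) x
            = - (w x * u t x)].

(* Only the values of S at the elements of H^s and at the times in [0, T] are
   constrained. *)
Definition is_solution_map {R : realType} {d : nat} (eps s T : R)
    (S : coeffs R d -> R -> coeffs R d) :=
  (forall u0, in_Hs s u0 -> in_CHs s T (S u0)) /\
  (forall u, smooth_solution eps T u ->
    forall t : R, t \in `[0, T] -> S (fourier (u 0)) t = fourier (u t)).

Definition unif_continuous_on_bounded {R : realType} {d : nat} (s T : R)
    (S : coeffs R d -> R -> coeffs R d) :=
  forall B : set (coeffs R d),
    (exists M : R, forall f, B f -> (Hs_norm s f <= M%:E)%E) ->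
    forall eta : R, 0 < eta ->
    exists2 delta : R, 0 < delta &
      forall f g, B f -> B g ->
        (Hs_norm s (f \- g)%R < delta%:E)%E ->
        (CHs_norm s T (fun t => S f t \- S g t)%R < eta%:E)%E.

(* Main.v *)
Require Import Defs.
From HB Require Import structures.
From mathcomp Require Import all_boot all_order all_algebra.
From mathcomp Require Import complex.
From mathcomp Require Import all_classical all_reals all_analysis.
From mathcomp Require Import ring lra.

Set Implicit Arguments.
Unset Strict Implicit.
Unset Printing Implicit Defensive.

Import Order.TTheory GRing.Theory Num.Theory.
Import numFieldNormedType.Exports.

Local Open Scope ring_scope.
Local Open Scope complex_scope.
Local Open Scope classical_set_scope.

(** The failure comes from explicit solutions, the plane waves
      u_a(t, x) = a exp(i (n.x - omega t)),
      omega = |n|^2 + eps^2 |n|^4 - a^2, a real.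
    The density |u_a|^2 = a^2 is constant in x, and (I - eps^2 Delta)^-1 fixes
    constants because its symbol is 1 at frequency 0; the equation thus reduces
    to that dispersion relation ([smooth_solution_plane_wave]).  The phase
    depends on the amplitude, through the term a^2 t.

    Write W = (1 + |n|^2)^s.  A single Fourier mode z at frequency n has H^s norm
    sqrt W |z| ([Hs_norm_single]), so unit H^s norm corresponds to the amplitude
    a = W^(-1/2).  Since s < 0, W tends to 0 as |n| grows ([small_weight]): the
    amplitude is large, and a small relative change of it moves the phase a lot.
    The amplitude b with b^2 = a^2 + pi / T makes the two waves differ by a phase
    of exactly pi at time T.  Initially they are at H^s distance
    sqrt (1 + W pi / T) - 1 <= W pi / T, which is as small as desired, whereas at
    time T they have opposite phases, so that their distance is the sum of their
    norms, at least 2.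

    The Fourier coefficients of these waves are needed in the literal form of an
    iterated integral; they follow from [torus_mean_trig], the orthogonality of
    the characters. *)

(** * Trigonometric functions of a linear form *)

(** Taking both a cosine and a sine term makes this family stable under
    directional derivatives, which only change p and q. *)
Definition trig {R : realType} {V : Type} (p q : R) (L : V -> R) (x : V) : R :=
  p * cos (L x) + q * sin (L x).

(** On the line through x directed by v the form L is affine, so that this is the
    one-variable chain rule. *)
Lemma is_derive_trig (R : realType) (V : normedModType R) (p q : R)
    (L : V -> R) (x v : V) : scalar L ->
  is_derive x v (trig p q L) (trig (q * L v) (- (p * L v)) L x).
Proof.
move=> linL.
have along t : L (t *: v + x) = t * L v + L x by rewrite linL.
pose g (t : R) := p * cos (t * L v + L x) + q * sin (t * L v + L x).
have dg : is_derive (0 : R) (1 : R) g (trig (q * L v) (- (p * L v)) L x).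
  have dL : is_derive (0 : R) (1 : R) (fun t => t * L v + L x) (L v).
    by apply: is_derive_eq; rewrite /GRing.scale/=; ring.
  have at0 : 0 * L v + L x = L x by rewrite mul0r add0r.
  have dcos : is_derive (0 : R) (1 : R) (cos \o (fun t => t * L v + L x))
      (- sin (0 * L v + L x) * L v) by exact: is_derive1_comp.
  have dsin : is_derive (0 : R) (1 : R) (sin \o (fun t => t * L v + L x))
      (cos (0 * L v + L x) * L v) by exact: is_derive1_comp.
  rewrite at0 in dcos dsin.
  rewrite (_ : g = (fun t => p * (cos \o (fun t => t * L v + L x)) t
                    + q * (sin \o (fun t => t * L v + L x)) t)) //.
  apply: is_derive_eq.
  by rewrite /trig /GRing.scale/=; ring.
have quotE : (fun h : R => h^-1 *: ((trig p q L \o shift x) (h *: v) - trig p q L x))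
    = (fun h : R => h^-1 *: ((g \o shift 0) (h *: 1) - g 0)).
  apply/funext => h; congr (_ *: _).
  by rewrite /= /trig /g along mul0r add0r addr0 [h *: 1]mulr1.
case: dg => dg dgE; split.
  by move: dg; rewrite /derivable -quotE.
by move: dgE; rewrite /derive -quotE.
Qed.

Lemma continuous_trig (R : realType) (V : topologicalType) (p q : R)
    (L : V -> R) : continuous L -> continuous (trig p q L).
Proof.
move=> cL x; apply: cvgD; apply: cvgM; do ?exact: cvg_cst.
  exact: (continuous_comp (cL x) (@continuous_cos R _)).
exact: (continuous_comp (cL x) (@continuous_sin R _)).
Qed.

Lemma smooth_trig (R : realType) (V : normedModType R) (p q : R) (L : V -> R) :
  scalar L -> continuous L -> smooth_real (trig p q L).
Proof.
move=> linL cL vs.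
have [p' [q' ->]] : exists p' q', iter_deriv vs (trig p q L) = trig p' q' L.
  elim: vs => [|v vs [p' [q' /= ->]]]; first by exists p, q.
  exists (q' * L v), (- (p' * L v)); apply/funext => x.
  exact: (derive_val (is_derive := is_derive_trig p' q' x v linL)).
split; first exact: continuous_trig.
by move=> x v; exact: (ex_derive (is_derive := is_derive_trig p' q' x v linL)).
Qed.

(** * Complex exponentials *)

Definition cis {R : realType} (theta : R) : R[i] := cos theta +i* sin theta.

Lemma cisD (R : realType) (a b : R) : cis (a + b) = cis a * cis b.
Proof. by rewrite /cis cosD sinD; simpc; congr (_ +i* _); ring. Qed.

Lemma cis0 (R : realType) : cis (0 : R) = 1.
Proof. by rewrite /cis cos0 sin0. Qed.

Lemma cispi (R : realType) : cis (pi : R) = -1.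
Proof. by rewrite /cis cospi sinpi; simpc. Qed.

Lemma norm_cis (R : realType) (a : R) : `|cis a| = 1.
Proof. by rewrite normc_def /= cos2Dsin2 sqrtr1. Qed.

(** Integer multiples of 2 pi, possibly negative ones, as they arise from the
    frequencies of the characters. *)
Lemma cis_2pi_int (R : realType) (k : int) : cis (k%:~R * (2 * pi) : R) = 1.
Proof.
have cisn (n : nat) : cis (n%:R * (2 * pi) : R) = 1.
  elim: n => [|n IHn]; first by rewrite mul0r cis0.
  rewrite -[n.+1]addn1 natrD mulrDl cisD IHn !mul1r mulrC mulr_natr.
  by rewrite /cis cos2pi sin2pi.
case: k => n; first exact: cisn.
rewrite NegzE mulrNz mulNr.
apply: (mulfI (_ : cis (n.+1%:R * (2 * pi)) != 0)).
  by rewrite cisn oner_neq0.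
by rewrite -cisD addrN cis0 cisn mulr1.
Qed.

(** The abstract form L covers both the functions of x alone, of t alone, and of
    the pair (t, x). *)
Definition wave {R : realType} {V : Type} (A : R[i]) (L : V -> R) (x : V) : R[i] :=
  A * cis (L x).

Lemma Re_wave (R : realType) (V : Type) (A : R[i]) (L : V -> R) :
  (fun x => complex.Re (wave A L x)) = trig (complex.Re A) (- complex.Im A) L.
Proof. by apply/funext => x; case: A => p q; rewrite /trig /= mulNr. Qed.

Lemma Im_wave (R : realType) (V : Type) (A : R[i]) (L : V -> R) :
  (fun x => complex.Im (wave A L x)) = trig (complex.Im A) (complex.Re A) L.
Proof. by apply/funext => x; case: A => p q; rewrite /trig /= addrC. Qed.

Lemma smooth_wave (R : realType) (V : normedModType R) (A : R[i]) (L : V -> R) :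
  scalar L -> continuous L -> smooth (wave A L).
Proof.
by move=> linL cL; split; rewrite ?Re_wave ?Im_wave; exact: smooth_trig.
Qed.

Lemma cderiv_wave (R : realType) (V : normedModType R) (A : R[i]) (L : V -> R)
    (v : V) : scalar L ->
  cderiv v (wave A L) = wave ('i%C * (L v)%:C * A) L.
Proof.
move=> linL; apply/funext => x; rewrite /cderiv Re_wave Im_wave.
rewrite (derive_val (is_derive := is_derive_trig _ _ x v linL)).
rewrite (derive_val (is_derive := is_derive_trig _ _ x v linL)).
case: A => p q; rewrite /wave /cis /trig /=; simpc.
by congr (_ +i* _); ring.
Qed.

(** * Fourier coefficients of plane waves *)

Lemma scalar_dotz (R : realType) (d : nat) (n : 'rV[int]_d) :
  scalar (@dotz R d n).
Proof.
move=> a u v; rewrite /dotz mulr_sumr -big_split /=.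
by apply: eq_bigr => j _; rewrite !mxE; ring.
Qed.

Lemma continuous_dotz (R : realType) (d : nat) (n : 'rV[int]_d) :
  continuous (@dotz R d n).
Proof.
move=> x.
apply: (@cvg_big R^o _ _ _ _ (@add_continuous R^o) _ _ _ _ _ (nbhs_filter x)).
move=> j _; by apply: cvgM; [exact: cvg_cst|exact: coord_continuous].
Qed.

Lemma dotz_delta (R : realType) (d : nat) (n : 'rV[int]_d) (j : 'I_d) :
  dotz n (delta_mx 0 j) = (n 0 j)%:~R :> R.
Proof.
rewrite /dotz (bigD1 j) //= big1 => [|k kj].
  by rewrite !mxE !eqxx mulr1 addr0.
by rewrite mxE (negbTE kj) mulr0.
Qed.

Lemma dotz0 (R : realType) (d : nat) : @dotz R d 0 = (fun=> 0).
Proof. by apply/funext => x; rewrite /dotz big1 // => j _; rewrite mxE mul0r. Qed.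

Lemma dotzB (R : realType) (d : nat) (n m : 'rV[int]_d) (x : 'rV[R]_d) :
  dotz (n - m) x = dotz n x + dotz (- m) x.
Proof.
rewrite /dotz -big_split /=; apply: eq_bigr => j _.
by rewrite !mxE -mulrDl -intrD.
Qed.

(** Overwriting a coordinate is a translation along it; linearity of n.x then
    gives its effect on the phase. *)
Lemma set_coordE (R : realType) (d : nat) (x : 'rV[R]_d) (j : 'I_d) (y : R) :
  set_coord x j y = (y - x 0 j) *: delta_mx 0 j + x.
Proof.
apply/rowP => k; rewrite !mxE eqxx /=.
by case: eqP => [->|_]; rewrite ?mulr1 ?subrK ?mulr0 ?add0r.
Qed.

Lemma dotz_set_coord (R : realType) (d : nat) (n : 'rV[int]_d) (x : 'rV[R]_d)
    (j : 'I_d) (y : R) :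
  dotz n (set_coord x j y) = (n 0 j)%:~R * y + (dotz n x - (n 0 j)%:~R * x 0 j).
Proof. by rewrite set_coordE scalar_dotz dotz_delta; ring. Qed.

Lemma torus_periodic_wave (R : realType) (d : nat) (A : R[i]) (n : 'rV[int]_d) :
  torus_periodic (wave A (@dotz R d n)).
Proof.
move=> x j; rewrite /wave addrC scalar_dotz dotz_delta cisD [_ * _%:~R]mulrC.
by rewrite cis_2pi_int mul1r.
Qed.

(** The integrand has a primitive of the same kind, which takes the same value at
    the two ends of the period. *)
Lemma integral_trig_period (R : realType) (p q C : R) (k : int) : k != 0 ->
  \int[lebesgue_measure]_(y in `[0, 2 * pi])
    (p * cos (k%:~R * y + C) + q * sin (k%:~R * y + C)) = 0.
Proof.
move=> k0; have kR0 : k%:~R != 0 :> R by rewrite intr_eq0.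
pose L (y : R) := k%:~R * y.
have linL : scalar L by move=> a u v; rewrite /L /GRing.scale /=; ring.
have cL : continuous L by move=> y; exact: mulrl_continuous.
(* The constant phase C is absorbed in the coefficients, so that the argument
   becomes linear in y. *)
pose p' := p * cos C + q * sin C; pose q' := q * cos C - p * sin C.
pose F := trig (- q' / k%:~R) (p' / k%:~R) L.
have dF (y : R) : is_derive y (1 : R) F (trig p' q' L y).
  have := is_derive_trig (- q' / k%:~R) (p' / k%:~R) y 1 linL.
  congr is_derive; rewrite /L mulr1 divfK // mulNr mulNr opprK divfK //.
have cF : continuous F by exact: continuous_trig.
have integrandE y : p * cos (k%:~R * y + C) + q * sin (k%:~R * y + C)
    = trig p' q' L y by rewrite cosD sinD /trig /p' /q' /L; ring.
under eq_Rintegral do rewrite integrandE.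
rewrite /Rintegral (@continuous_FTC2 _ _ F) //=.
- have := cis_2pi_int R k; rewrite /cis /F /trig /L => -[-> ->].
  by rewrite !mulr0 cos0 sin0 mulr0 subrr.
- by rewrite mulr_gt0 ?pi_gt0.
- by apply: continuous_subspaceT; exact: continuous_trig.
- split; first by move=> y _; exact: (ex_derive (is_derive := dF y)).
  + by apply: cvg_at_right_filter; exact: cF.
  + by apply: cvg_at_left_filter; exact: cF.
- by move=> y _; rewrite derive1E (derive_val (is_derive := dF y)).
Qed.

Lemma Rintegral_torus_cst (R : realType) (c : R) :
  \int[lebesgue_measure]_(y in `[0, 2 * pi]) c = (2 * pi) * c.
Proof.
rewrite Rintegral_cst //= lebesgue_measure_itv /= lte_fin.
by rewrite mulr_gt0 ?pi_gt0 // -EFinB /= subr0 mulrC.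
Qed.

(** Integrating over a coordinate j either multiplies by 2 pi, when k_j = 0 makes
    the integrand independent of that coordinate, or gives 0. *)
Lemma torus_mean_trig (R : realType) (d : nat) (p q : R) (k : 'rV[int]_d) :
  torus_mean (trig p q (dotz k)) = if k == 0 then p else 0.
Proof.
rewrite /torus_mean.
set mean := foldr _ _.
(* After the coordinates of l have been integrated out, the result vanishes as
   soon as one of these coordinates of k is nonzero. *)
have meanE (l : seq 'I_d) : mean l = fun x =>
    if all (fun j => k 0 j == 0) l
    then (2 * pi) ^+ size l * trig p q (dotz k) x else 0.
  elim: l => [|j l IHl]; first by apply/funext => x; rewrite /= mul1r.
  rewrite /= -/mean IHl; apply/funext => x.
  case: (all _ l); last by rewrite andbF Rintegral_torus_cst mulr0.
  rewrite andbT; under eq_Rintegral do rewrite /trig dotz_set_coord.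
  have [->|kj0] := eqVneq (k 0 j) 0.
    under eq_Rintegral do rewrite !mul0r add0r subr0.
    by rewrite Rintegral_torus_cst exprS mulrA.
  under eq_Rintegral do rewrite mulrDr !mulrA.
  exact: integral_trig_period.
rewrite meanE size_enum_ord.
have -> : all (fun j => k 0 j == 0) (enum 'I_d) = (k == 0).
  apply/allP/eqP => [k0|-> j _]; last by rewrite mxE.
  by apply/rowP => j; rewrite mxE; apply/eqP/k0; rewrite mem_enum.
case: ifP => [/eqP ->|_]; last by rewrite mulr0.
rewrite dotz0 /trig cos0 sin0 mulr0 addr0 mulr1 mulKf //.
by rewrite expf_neq0 // mulf_neq0 // gt_eqF // pi_gt0.
Qed.

Lemma fourier_wave (R : realType) (d : nat) (A : R[i]) (n : 'rV[int]_d) :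
  fourier (wave A (dotz n)) = fun m => if m == n then A else 0.
Proof.
apply/funext => m; rewrite /fourier.
have prodE : (fun x => wave A (dotz n) x * character (- m) x)
           = wave A (@dotz R d (n - m)).
  by apply/funext => x; rewrite /wave dotzB cisD mulrA.
rewrite (congr1 (fun f x => complex.Re (f x)) prodE).
rewrite (congr1 (fun f x => complex.Im (f x)) prodE).
rewrite Re_wave Im_wave !torus_mean_trig subr_eq0 [m == n]eq_sym.
by case: eqP => // _; case: (A).
Qed.

(** A constant is a wave of frequency 0, where the symbol equals 1. *)
Lemma is_multiplier_cst (R : realType) (d : nat) (eps : R) (c : R[i]) :
  is_multiplier (@inv_symbol R d eps) (fun=> c) (fun=> c).
Proof.
have cE : (fun=> c) = wave c (@dotz R d 0).
  by apply/funext => x; rewrite /wave dotz0 cis0 mulr1.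
rewrite cE; split.
  by apply: smooth_wave; [exact: scalar_dotz|exact: continuous_dotz].
  exact: torus_periodic_wave.
move=> n; rewrite fourier_wave; case: eqP => [->|_]; last by rewrite mulr0.
rewrite /inv_symbol /freq_sqr big1 => [|j _]; last by rewrite mxE expr0n.
by rewrite mulr0 addr0 invr1 mul1r.
Qed.

(** * Plane wave solutions *)

Lemma laplacian_wave (R : realType) (d : nat) (A : R[i]) (n : 'rV[int]_d) :
  laplacian (wave A (@dotz R d n)) = wave (- (freq_sqr n)%:C * A) (dotz n).
Proof.
apply/funext => x; rewrite /laplacian /freq_sqr /wave.
rewrite [in RHS]rmorph_sum /= -sumrN !mulr_suml; apply: eq_bigr => j _.
rewrite (cderiv_wave _ _ (scalar_dotz n)) (cderiv_wave _ _ (scalar_dotz n)).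
rewrite dotz_delta /wave rmorphXn /= expr2 -mulNr -mulN1r -(sqr_i R).
ring.
Qed.

Definition plane_wave {R : realType} {d : nat} (eps a : R) (n : 'rV[int]_d)
    (t : R) (x : 'rV[R]_d) : R[i] :=
  a%:C * cis (dotz n x
              - (freq_sqr n + eps ^+ 2 * freq_sqr n ^+ 2 - a ^+ 2) * t).

Lemma plane_wave_at_time (R : realType) (d : nat) (eps a : R) (n : 'rV[int]_d)
    (t : R) :
  plane_wave eps a n t =
  wave (a%:C * cis (- ((freq_sqr n + eps ^+ 2 * freq_sqr n ^+ 2 - a ^+ 2) * t)))
       (dotz n).
Proof.
by apply/funext => x; rewrite /plane_wave /wave cisD -mulrA [cis _ * _]mulrC.
Qed.

(** Since |u|^2 = a^2 is fixed by the smoothing operator, the nonlinearity is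
    multiplication by - a^2 and every term of the equation is a multiple of u. *)
Lemma smooth_solution_plane_wave (R : realType) (d : nat) (eps T a : R)
    (n : 'rV[int]_d) : smooth_solution eps T (plane_wave eps a n).
Proof.
split.
- set om := freq_sqr n + eps ^+ 2 * freq_sqr n ^+ 2 - a ^+ 2.
  apply: (@smooth_wave _ (R * 'rV[R]_d)%type a%:C
    (fun z => dotz n z.2 - om * z.1)).
    move=> c y z /=; rewrite scalar_dotz /GRing.scale /=; ring.
  move=> z; apply: cvgB.
    apply: (@continuous_comp _ _ _ snd (dotz n)); first exact: cvg_snd.
    exact: continuous_dotz.
  by apply: cvgM; [exact: cvg_cst|exact: cvg_fst].
- by move=> t; rewrite plane_wave_at_time; exact: torus_periodic_wave.
move=> t _; exists (fun=> (a ^+ 2)%:C).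
  rewrite (_ : (fun x => _) = fun=> (a ^+ 2)%:C); first exact: is_multiplier_cst.
  apply/funext => x; rewrite /plane_wave normrM norm_cis mulr1.
  by rewrite -add_Re2_Im2 /= expr0n addr0.
move=> x.
set om := freq_sqr n + eps ^+ 2 * freq_sqr n ^+ 2 - a ^+ 2.
have inE : (fun t' => plane_wave eps a n t' x)
    = wave (a%:C * cis (dotz n x)) (fun t' => - om * t').
  by apply/funext => t'; rewrite /plane_wave /wave cisD mulrA mulNr.
rewrite inE cderiv_wave; last by move=> c y z; rewrite /GRing.scale /=; ring.
rewrite plane_wave_at_time !laplacian_wave /wave -/om mulr1 mulNr.
have omE : om%:C = (freq_sqr n)%:C + (eps ^+ 2)%:C * (freq_sqr n)%:C ^+ 2
                   - (a ^+ 2)%:C :> R[i].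
  by rewrite /om rmorphB rmorphD rmorphM (rmorphXn _ 2 (freq_sqr n)).
have iom z : 'i%C * ('i%C * (- om)%:C * z) = om%:C * z :> R[i].
  by rewrite !mulrA -expr2 sqr_i rmorphN mulN1r opprK.
rewrite mulrA iom omE; ring.
Qed.

(** * Separation of two plane waves *)

Lemma Hs_norm_single (R : realType) (d : nat) (s : R) (n : 'rV[int]_d)
    (z : R[i]) :
  Hs_norm s (fun m => if m == n then z else 0)
  = (Num.sqrt ((1 + freq_sqr n) `^ s) * complex.Re `|z|)%:E.
Proof.
have z0 : 0 <= complex.Re `|z| by rewrite normc_def /= sqrtr_ge0.
rewrite /Hs_norm.
rewrite (_ : \esum_(m in _) _ =
             ((1 + freq_sqr n) `^ s * complex.Re `|z| ^+ 2)%:E).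
  by rewrite /= sqrtrM ?powR_ge0 // sqrtr_sqr ger0_norm.
rewrite (esumID [set n]) => [|m _]; last first.
  by rewrite lee_fin mulr_ge0 ?powR_ge0 ?sqr_ge0.
rewrite setTI esum_set1 /= ?eqxx; last first.
  by rewrite lee_fin mulr_ge0 ?powR_ge0 ?sqr_ge0.
rewrite esum1 ?adde0 // => m [_ mn].
by case: eqP => [/mn //|_]; rewrite Normc.normc0 expr0n mulr0.
Qed.

(** Negative regularity enters here: H^s hardly sees high frequencies, so that
    a wave of bounded H^s norm may have a large amplitude. *)
Lemma small_weight (R : realType) (d : nat) (s e : R) :
  (1 <= d)%N -> s < 0 -> 0 < e ->
  exists n : 'rV[int]_d, (1 + freq_sqr n) `^ s < e.
Proof.
move=> d1 s0 e0.
(* The constant vector N has |n|^2 >= N^2 >= N, and t |-> t^s decreases, with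
   X^s = e. *)
pose X := e `^ s^-1; pose N := Num.bound X.
exists (const_mx N%:Z); set F := freq_sqr _.
have X0 : 0 < X by exact: powR_gt0.
have XN : X < N%:R by rewrite archi_boundP ?ltW.
have NF : N%:R <= F.
  rewrite /F /freq_sqr (bigD1 (Ordinal d1)) //= mxE.
  apply: (@le_trans _ _ (N%:R ^+ 2)); last first.
    by rewrite lerDl sumr_ge0 // => j _; rewrite sqr_ge0.
  by rewrite -natrX ler_nat; case: (N) => // k; rewrite leq_pmulr.
have -> : e = X `^ s by rewrite /X -powRrM mulVf ?lt_eqF // powRr1 // ltW.
rewrite -[s]opprK [in ltLHS]powRN [in ltRHS]powRN.
rewrite ltf_pV2 ?posrE ?powR_gt0 //; last by lra.
by apply: gt0_ltr_powR; rewrite ?oppr_gt0 ?nnegrE //; lra.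
Qed.

Theorem mainTheorem3 (R : realType) (d : nat) (eps s T : R)
    (d_ge1 : (1 <= d)%N) (eps_gt0 : 0 < eps) (s_lt0 : s < 0) (T_gt0 : 0 < T)
    (S : coeffs R d -> R -> coeffs R d) (S_sol : is_solution_map eps s T S) :
  ~ unif_continuous_on_bounded s T S.
Proof.
case: S_sol => _ S_smooth unifS.
have pi0 := pi_gt0 R.
have [|delta delta0 S_close] :=
  unifS [set f | (Hs_norm s f <= 2%:E)%E] _ 1 ltr01; first by exists 2.
have [|n Wlt] := @small_weight R d s (Num.min delta 1 * (T / pi)) d_ge1 s_lt0.
  by rewrite mulr_gt0 ?divr_gt0 // lt_min delta0 ltr01.
set W := (1 + freq_sqr n) `^ s in Wlt.
have W0 : 0 < W.
  rewrite powR_gt0 // ltr_wpDr // sumr_ge0 // => j _; exact: sqr_ge0.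
have rW0 : 0 < Num.sqrt W by rewrite sqrtr_gt0.
pose g := W * (pi / T).
have g0 : 0 < g by rewrite mulr_gt0 ?divr_gt0.
have : g < Num.min delta 1.
  by move: Wlt; rewrite -ltr_pdivrMr ?divr_gt0 // invf_div.
rewrite lt_min => /andP[g_delta g1].
(* The waves of amplitude a and b have H^s norms 1 and sqrt (1 + g), and the
   difference b^2 - a^2 = pi / T of their frequencies is worth a half turn at
   time T. *)
pose a := (Num.sqrt W)^-1; pose b := Num.sqrt (W^-1 + pi / T).
have a0 : 0 <= a by rewrite invr_ge0 ltW.
have b0 : 0 <= b by exact: sqrtr_ge0.
have Wa : Num.sqrt W * a = 1 by rewrite mulfV // gt_eqF.
have Wb : Num.sqrt W * b = Num.sqrt (1 + g).
  by rewrite -sqrtrM ?ltW // mulrDr mulfV ?gt_eqF.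
have ab2 : b ^+ 2 - a ^+ 2 = pi / T.
  rewrite sqr_sqrtr; last by rewrite addr_ge0 ?invr_ge0 ?divr_ge0 ?ltW.
  by rewrite exprVn sqr_sqrtr ?(ltW W0) // addrAC subrr add0r.
have ab : a <= b.
  rewrite -(@ler_pXn2r _ 2) // -subr_ge0 ab2 ltW // divr_gt0 //.
have rg1 : 1 <= Num.sqrt (1 + g) by rewrite -Wb -Wa ler_pM2l.
have rg2 : Num.sqrt (1 + g) <= 1 + g.
  rewrite -[leRHS]ger0_norm; last by lra.
  rewrite -sqrtr_sqr ler_sqrt; last by rewrite sqr_ge0.
  by rewrite expr2 ler_peMr; lra.
pose om (c : R) := freq_sqr n + eps ^+ 2 * freq_sqr n ^+ 2 - c ^+ 2.
pose f c : coeffs R d := fourier (plane_wave eps c n 0).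
have fourierE c t : fourier (plane_wave eps c n t)
    = fun m => if m == n then c%:C * cis (- (om c * t)) else 0.
  by rewrite plane_wave_at_time fourier_wave.
have subE (z w : R[i]) : (fun m => if m == n then z else 0) \-
    (fun m => if m == n then w else 0)
    = fun m : 'rV[int]_d => if m == n then z - w else 0.
  by apply/funext => m /=; case: eqP => // _; rewrite subr0.
have fE c : f c = fun m => if m == n then c%:C else 0.
  by rewrite /f fourierE mulr0 oppr0 cis0 mulr1.
have normC c : 0 <= c -> complex.Re `|c%:C| = c :> R.
  by move=> c0; rewrite ger0_norm // ler0c.
have fB c : Num.sqrt W * c <= 2 -> 0 <= c -> (Hs_norm s (f c) <= 2%:E)%E.
  by move=> cB c0; rewrite fE Hs_norm_single lee_fin normC.
have fbB : (Hs_norm s (f b) <= 2%:E)%E by apply: fB; rewrite // Wb; lra.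
have faB : (Hs_norm s (f a) <= 2%:E)%E by apply: fB; rewrite // Wa; lra.
have close : (Hs_norm s (f b \- f a)%R < delta%:E)%E.
  rewrite !fE subE Hs_norm_single lte_fin -rmorphB normC ?subr_ge0 //.
  by rewrite mulrBr Wb Wa; lra.
have := S_close _ _ fbB faB close.
apply/negP; rewrite -leNgt.
have TI : T \in `[0, T]%R by rewrite in_itv /= lexx ltW.
apply: (@le_trans _ _ (Hs_norm s (S (f b) T \- S (f a) T))); last first.
  by apply: ereal_sup_ubound; exists T.
rewrite !(S_smooth _ (smooth_solution_plane_wave _ _ _ _)) //.
rewrite !fourierE subE Hs_norm_single lee_fin.
(* At time T the two waves are in phase opposition. *)
have -> : - (om b * T) = - (om a * T) + pi.
  have : (b ^+ 2 - a ^+ 2) * T = pi by rewrite ab2 divfK // gt_eqF.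
  by rewrite /om => <-; ring.
rewrite cisD cispi mulrN1 mulrN -opprD -mulrDl normrN normrM norm_cis mulr1.
rewrite -rmorphD normC ?addr_ge0 // mulrDr Wa Wb; lra.
Qed.
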